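(* Consider the problem $\min_{y\in\mathbb{R}^n}\phi(y):=f(y)+h(y)$ under the standing assumptions given in the context. Suppose the sequence $\{y_k\}$ generated by Algorithm mFISTA (described in the context) is convergent. Then Algorithm mFISTA finds an $\epsilon$-approximate solution of the problem in at most $o(\epsilon^{-2})$ iterations; that is, the number $N(\epsilon)$ of iterations until termination with tolerance $\epsilon$ satisfies $N(\epsilon)/\epsilon^{-2}\to0$ as $\epsilon\to0^+$.
   Context: **Problem and standing assumptions.** $\Omega\subseteq\mathbb{R}^n$ is a closed convex set. $f$ is a real-valued function on $\mathbb{R}^n$, possibly nonconvex on $\Omega$, differentiable with $\|\nabla f(u_1)-\nabla f(u_2)\|\le L\|u_1-u_2\|$ for all $u_1,u_2\in\Omega$, where $L>0$. $h:\mathbb{R}^n\to(-\infty,+\infty]$ is a proper lower semicontinuous convex function (possibly nonsmooth) with $\mathrm{dom}\,h$ closed and bounded, $\mathrm{dom}\,h\subseteq\Omega$, and $\|y\|\le C$ for all $y\in\mathrm{dom}\,h$, where $C>0$ is a constant. $P_\Omega$ denotes the Euclidean projection onto $\Omega$, and $\partial h$ the convex subdifferential. For a differentiable $g$, write $l_g(u_1;u_2):=g(u_2)+\langle\nabla g(u_2),u_1-u_2\rangle$. **$\epsilon$-approximate solution.** A pair $(y,v)$ with $v\in\nabla f(y)+\partial h(y)$ and $\|v\|\le\epsilon$. **Algorithm mFISTA.** Input: $\epsilon>0$, an initial point $x_1=y_0\in\mathrm{dom}\,h$, $a_0=1$, $L_1=0$. For $k=1,2,\dots$: 1. Set $f_k(y)=f(y)+\frac{L_k}{2}\|y-y_{k-1}\|^2$.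 2. Compute $y_k=\operatorname{argmin}_{y\in\mathbb{R}^n}\{l_{f_k}(y;x_k)+h(y)+2L\|y-x_k\|^2\}$. 3. Find $a_k>0$ with $a_k(a_k-1)=a_{k-1}^2$. 4. Compute $v_k=\nabla f(y_k)-\nabla f(x_k)+L_k[y_{k-1}-x_k]+4L[x_k-y_k]$ and $x_{k+1}=P_\Omega\left(y_k+\frac{a_{k-1}-1}{a_k}(y_k-y_{k-1})\right)$. 5. Set $A_k=\frac{2(l_f(y_k;x_{k+1})-f(y_k))}{\|y_k-x_{k+1}\|^2}$ if $y_k\neq x_{k+1}$ and $A_k=0$ otherwise; set $L_{k+1}=\max\{0,A_k\}$. Termination: the algorithm exits at the first $k$ with $\|v_k\|\le\epsilon$ and outputs $(y_k,v_k)$; this $k$ is the number of iterations $N(\epsilon)$. The iterates do not depend on $\epsilon$; the sequence $\{y_k\}$ in the hypothesis is the infinite sequence obtained by running Steps 1–5 without the termination test. The problem data and the initial point are fixed as $\epsilon\to0^+$. *)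

(* Defs.v *)
From HB Require Import structures.
From mathcomp Require Import all_boot all_order all_algebra.
From mathcomp Require Import all_classical all_reals all_analysis.

Set Implicit Arguments.
Unset Strict Implicit.
Unset Printing Implicit Defensive.

Import Order.TTheory GRing.Theory Num.Theory.
Import numFieldNormedType.Exports.

Local Open Scope classical_set_scope.
Local Open Scope ring_scope.

Section Defs.
Context {R : realType} {n : nat}.
Local Notation E := 'rV[R]_n.
Implicit Types (f g : E -> R^o) (h : E -> \bar R) (u v x y z : E).

(* The library norm on 'rV[R]_n is the sup norm (its topology is the usual
   one); the inner product and norm below are the Euclidean ones. *)
Definition dot u v : R := \sum_(i < n) u 0 i * v 0 i.

Definition enorm u : R := Num.sqrt (dot u u).

(* The coordinates are those of the Frechet differential; the value is
   meaningful only at points where g is differentiable. *)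
Definition grad g x : E := \row_(i < n) 'd g x (delta_mx 0 i).

Definition lin g u1 u2 : R := g u2 + dot (grad g u2) (u1 - u2).

Definition edom h : set E := [set y | (h y < +oo)%E].

Definition ereal_proper h : Prop :=
  (forall y, h y != -oo%E) /\ (exists y, (h y < +oo)%E).

Definition ereal_convex h : Prop :=
  forall x y (t : R), 0 < t < 1 ->
    (h (t *: x + (1 - t) *: y)%R <= t%:E * h x + (1 - t)%R%:E * h y)%E.

Definition subdiff h y : set E :=
  [set s | forall z, (h y + (dot s (z - y))%R%:E <= h z)%E].

Definition is_argmin (F : E -> \bar R) y : Prop := forall z, (F y <= F z)%E.

Definition is_proj (Omega : set E) z p : Prop :=
  Omega p /\ forall q, Omega q -> enorm (z - p) <= enorm (z - q).

Definition approx_solution f h (eps : R) y v : Prop :=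
  (exists2 s, subdiff h y s & v = grad f y + s) /\ enorm v <= eps.

Definition convexified f (Lk : R) c : E -> R^o :=
  fun y => f y + Lk / 2 * enorm (y - c) ^+ 2.

Definition curvature f u z : R :=
  if u == z then 0 else 2 * (lin f u z - f u) / enorm (u - z) ^+ 2.

(* [Ls k] stands for L_k. Iteration k >= 1 of the algorithm is the instance
   k.-1 of each field, so that [k.+1] is the current iteration and [k] the
   previous one; [x 0], [v 0] and [Ls 0] are not used. *)
Record mFISTA_run (Omega : set E) f h (L : R)
    (x y v : nat -> E) (a Ls : nat -> R) : Prop := {
  run_y0 : edom h (y 0%N);
  run_x1 : x 1%N = y 0%N;
  run_a0 : a 0%N = 1;
  run_L1 : Ls 1%N = 0;
  run_y : forall k, is_argmin
    (fun u => ((lin (convexified f (Ls k.+1) (y k)) u (x k.+1))%R%:E + h u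
               + (2 * L * enorm (u - x k.+1) ^+ 2)%R%:E)%E)
    (y k.+1);
  run_a : forall k, 0 < a k.+1 /\ a k.+1 * (a k.+1 - 1) = a k ^+ 2;
  run_v : forall k, v k.+1 =
    grad f (y k.+1) - grad f (x k.+1) + Ls k.+1 *: (y k - x k.+1)
    + (4 * L) *: (x k.+1 - y k.+1);
  run_x : forall k, is_proj Omega
    (y k.+1 + ((a k - 1) / a k.+1) *: (y k.+1 - y k)) (x k.+2);
  run_L : forall k, Ls k.+2 = Num.max 0 (curvature f (y k.+1) (x k.+2))
}.

Definition terminates_at (v : nat -> E) (eps : R) (N : nat) : Prop :=
  [/\ (1 <= N)%N, enorm (v N) <= eps
    & forall k, (1 <= k < N)%N -> eps < enorm (v k)].

End Defs.

(* Main.v *)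
(* Run the potential-function argument of accelerated proximal gradient,
   comparing with the limit w of (y_k). Since f is only L-smooth, each step adds
   to the convex potential inequality an error a_k * L/2 (|x_{k+1} - w|^2 +
   |y_k - w|^2), and convergence makes these errors o(1) * a_k. Because h is
   lower semicontinuous, phi(y_k) >= phi(w) - o(1), so the inequality bounds
   sum_{k < M} a_k^2 |v_{k+1}|^2 by o(M^2), while sum_{k < M} a_k^2 >= M^3 / 12.
   Hence if |v_k| > eps for all k <= M then eps^2 M = o(1). *)

Require Import Defs.
From mathcomp Require Import all_boot all_order all_algebra.
From mathcomp Require Import all_classical all_reals all_analysis.
From mathcomp Require Import ring lra.

Set Implicit Arguments.
Unset Strict Implicit.
Unset Printing Implicit Defensive.

Import Order.TTheory GRing.Theory Num.Theory.
Import numFieldNormedType.Exports.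
Local Open Scope classical_set_scope.
Local Open Scope ring_scope.

(** * Algebra of the Euclidean inner product *)

Section dot.
Context {R : realType} {n : nat}.
Implicit Types u v w : 'rV[R]_n.

Lemma dotC u v : dot u v = dot v u.
Proof. by apply: eq_bigr => i _; rewrite mulrC. Qed.

Lemma dotDl u v w : dot (u + v) w = dot u w + dot v w.
Proof. by rewrite -big_split; apply: eq_bigr => i _; rewrite !mxE mulrDl. Qed.

Lemma dotZl (t : R) u v : dot (t *: u) v = t * dot u v.
Proof. by rewrite /dot mulr_sumr; apply: eq_bigr => i _; rewrite !mxE mulrA. Qed.

Lemma dotNl u v : dot (- u) v = - dot u v.
Proof. by rewrite -scaleN1r dotZl mulN1r. Qed.

Lemma dotDr u v w : dot u (v + w) = dot u v + dot u w.
Proof. by rewrite dotC dotDl !(dotC _ u). Qed.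

Lemma dotZr (t : R) u v : dot u (t *: v) = t * dot u v.
Proof. by rewrite dotC dotZl dotC. Qed.

Lemma dotNr u v : dot u (- v) = - dot u v.
Proof. by rewrite dotC dotNl dotC. Qed.

Lemma dot0l v : dot 0 v = 0.
Proof. by rewrite -(scale0r v) dotZl mul0r. Qed.

Lemma dot0r v : dot v 0 = 0.
Proof. by rewrite dotC dot0l. Qed.

Definition dotE := (dotDl, dotDr, dotNl, dotNr, dotZl, dotZr).

Lemma dot_ge0 u : 0 <= dot u u.
Proof. by apply: sumr_ge0 => i _; rewrite -expr2 sqr_ge0. Qed.

Lemma dot_eq0 u : (dot u u == 0) = (u == 0).
Proof.
apply/idP/eqP => [|->]; last by rewrite dot0l.
rewrite psumr_eq0 => [/allP u0|i _]; last by rewrite -expr2 sqr_ge0.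
apply/rowP => i; rewrite mxE; apply/eqP.
by have := u0 i (mem_index_enum i); rewrite mulf_eq0 orbb.
Qed.

Lemma dot_subC u v : dot (u - v) (u - v) = dot (v - u) (v - u).
Proof. by rewrite -opprB dotNl dotNr opprK. Qed.

Lemma dot_sub_gt0 u v : u != v -> 0 < dot (u - v) (u - v).
Proof. by move=> uv; rewrite lt_neqAle dot_ge0 eq_sym dot_eq0 subr_eq0 uv. Qed.

Lemma enorm_ge0 u : 0 <= enorm u.
Proof. exact: sqrtr_ge0. Qed.

Lemma sqr_enorm u : enorm u ^+ 2 = dot u u.
Proof. by rewrite sqr_sqrtr ?dot_ge0. Qed.

Lemma enorm_le_sqr u v : (enorm u <= enorm v) = (dot u u <= dot v v).
Proof. by rewrite ler_sqrt ?dot_ge0. Qed.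

Lemma enorm_leZ (c : R) u v : 0 <= c ->
  enorm u <= c * enorm v -> dot u u <= c ^+ 2 * dot v v.
Proof.
move=> c0 huv; rewrite -!sqr_enorm -exprMn ler_sqr// nnegrE ?enorm_ge0//.
by rewrite mulr_ge0 ?enorm_ge0.
Qed.

(** Cauchy-Schwarz without square roots: bound [dot u u] in the expansion of the nonnegative
    [dot (u + c *: v) (u + c *: v)], then cancel [c]. *)
Lemma dot_ge_lip (c : R) u v : 0 < c ->
  dot u u <= c ^+ 2 * dot v v -> - (c * dot v v) <= dot u v.
Proof.
move=> c0 huv; have := dot_ge0 (u + c *: v); rewrite !dotE (dotC v u) => h.
rewrite -(ler_pM2l c0); nra.
Qed.

Lemma dot_le_lip (c : R) u v : 0 < c ->
  dot u u <= c ^+ 2 * dot v v -> dot u v <= c * dot v v.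
Proof.
move=> c0 huv; have := @dot_ge_lip c (- u) v c0.
by rewrite !dotE opprK => /(_ huv); rewrite lerN2.
Qed.

Lemma dotD3_le u v w :
  dot (u + v + w) (u + v + w) <= 3 * (dot u u + dot v v + dot w w).
Proof.
have := dot_ge0 (u - v); have := dot_ge0 (v - w); have := dot_ge0 (u - w).
rewrite !dotE (dotC v u) (dotC w u) (dotC w v); lra.
Qed.

Lemma dist2_triangle u v w :
  dot (u - w) (u - w) <= 2 * dot (u - v) (u - v) + 2 * dot (v - w) (v - w).
Proof.
have := dot_ge0 (u - v - (v - w)).
rewrite !dotE !(dotC v u) !(dotC w u) !(dotC w v); lra.
Qed.

End dot.

(** Divide by [t] and let [t] tend to 0. This turns minimality along a segment into a first-order
    optimality condition. *)
Lemma ge0_of_quadratic {R : realType} (c d : R) :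
  (forall t, 0 < t < 1 -> 0 <= t * c + t ^+ 2 * d) -> 0 <= c.
Proof.
move=> H; rewrite leNgt; apply/negP => c0.
(* If [c < 0], this [t] is below 1 and makes [t * |d|] at most [- c / 2], so [c + t * d] is still
   negative. *)
pose t := - c / (2 * (`|d| + `|c| + 1)).
have hn := normr_ge0 d; have hc : `|c| = - c by rewrite ltr0_norm.
have dle : d <= `|d| by exact: ler_norm.
have den : 0 < 2 * (`|d| + `|c| + 1) by rewrite hc; lra.
have tE : t * (2 * (`|d| + `|c| + 1)) = - c by rewrite divfK// gt_eqF.
have t0 : 0 < t by rewrite divr_gt0//; lra.
have t1 : t < 1 by rewrite ltr_pdivrMr// hc; lra.
have := H t; rewrite t0 t1 => /(_ isT).
rewrite expr2 -mulrA -mulrDr pmulr_rge0//.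
have : t * d <= t * `|d| by rewrite ler_pM2l.
have : 0 <= t * `|c| by rewrite mulr_ge0// ltW.
nra.
Qed.

Lemma is_derive_quadratic {R : realType} (A B C t : R) :
  is_derive t 1 (fun s : R => A + (s * B + s ^+ 2 * C) : R) (B + 2 * t * C).
Proof.
have -> : (fun s : R => A + (s * B + s ^+ 2 * C)) = cst A + (B *: id + C *: (id * id)).
  by apply/funext => s; rewrite !fctE /GRing.scale/= expr2 (mulrC B) (mulrC C).
have D1 := is_derive_id t (1 : R).
have D2 := @is_deriveM R R id id t 1 1 1 D1 D1.
have D3 := is_deriveD (is_deriveZ B D1) (is_deriveZ C D2).
apply: (is_derive_eq (is_deriveD (is_derive_cst A t (1 : R)) D3)).
by rewrite /GRing.scale/=; ring.
Qed.

(** * Gradients, the descent lemma and projections *)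

Section gradient.
Context {R : realType} {n : nat}.
Implicit Types (f : 'rV[R]_n -> R^o) (p u z d : 'rV[R]_n).

Lemma diff_grad f p d : 'd f p d = dot (grad f p) d.
Proof.
rewrite {1}(row_sum_delta d) linear_sum; apply: eq_bigr => i _.
by rewrite linearZ /= !mxE mulrC.
Qed.

Lemma is_derive_line f z d (t : R) : differentiable f (z + t *: d) ->
  is_derive t 1 (fun s : R => f (z + s *: d) : R) (dot (grad f (z + t *: d)) d).
Proof.
move=> df.
pose line (s : R) := z + s *: d.
have lD : is_diff t line ( *:%R^~ d).
  have -> : *:%R^~ d = (0 : R -> 'rV[R]_n) + *:%R^~ d by apply/funext => s; rewrite add0r.
  exact: is_diffD.
have dl : differentiable line t by exact: ex_diff.
have dg : differentiable (f \o line) t by exact: differentiable_comp.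
apply: DeriveDef; first exact/derivable1_diffP.
rewrite (deriveE _ dg) (diff_comp dl df)/=.
by rewrite (@diff_val _ _ _ _ _ _ _ lD) scale1r diff_grad.
Qed.

Lemma differentiable_dist2 c p :
  differentiable (fun u : 'rV[R]_n => dot (u - c) (u - c) : R^o) p.
Proof.
pose g i : 'rV[R]_n -> R := (fun u : 'rV[R]_n => u 0 i) - cst (c 0 i).
have -> : (fun u : 'rV[R]_n => dot (u - c) (u - c) : R^o) = \sum_(i < n) g i * g i.
  by apply/funext => u; rewrite fct_sumE; apply: eq_bigr => i _; rewrite !mxE.
have gD i : differentiable (g i) p.
  by apply: differentiableB => //; exact: differentiable_coord.
by apply: differentiable_sum => i; exact: differentiableM.
Qed.

(** Along the line [p + s *: d] the squared distance is a quadratic polynomial in [s], whose linear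
    coefficient is the derivative. *)
Lemma derive_dist2 c p d :
  'D_d (fun u : 'rV[R]_n => dot (u - c) (u - c) : R^o) p = 2 * dot (p - c) d.
Proof.
set q := (fun u : 'rV[R]_n => _).
have qline : is_derive (0 : R) 1 (fun s : R => q (p + s *: d) : R) (dot (grad q p) d).
  have := @is_derive_line q p d 0; rewrite scale0r addr0; apply.
  exact: differentiable_dist2.
rewrite deriveE ?diff_grad; last exact: differentiable_dist2.
rewrite -(@derive_val _ _ _ _ _ _ _ qline).
have -> : (fun s : R => q (p + s *: d) : R) =
    (fun s => q p + (s * (2 * dot (p - c) d) + s ^+ 2 * dot d d)).
  by apply/funext => s; rewrite /q !dotE !(dotC d) !(dotC c p); ring.
have [_ ->] := is_derive_quadratic (q p) (2 * dot (p - c) d) (dot d d) 0.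
by rewrite mulr0 mul0r addr0.
Qed.

Lemma grad_convexified f (l : R) c p : differentiable f p ->
  grad (convexified f l c) p = grad f p + l *: (p - c).
Proof.
move=> df; have dq := differentiable_dist2 c p.
have -> : convexified f l c =
    f + (l / 2) *: (fun u : 'rV[R]_n => dot (u - c) (u - c) : R^o).
  by apply/funext => u; rewrite /convexified sqr_enorm.
have dlq : differentiable ((l / 2) *: (fun u : 'rV[R]_n => dot (u - c) (u - c) : R^o)) p.
  exact: differentiableZ.
have grad_coord (g : 'rV[R]_n -> R^o) (i : 'I_n) :
    differentiable g p -> grad g p 0 i = 'D_(delta_mx 0 i) g p.
  by move=> dg; rewrite mxE (deriveE _ dg).
apply/rowP => i; rewrite (grad_coord _ _ (differentiableD df dlq)).
rewrite (deriveD (@diff_derivable _ _ _ _ _ _ df) (@diff_derivable _ _ _ _ _ _ dlq)).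
rewrite (deriveZ _ (@diff_derivable _ _ _ _ _ _ dq)) derive_dist2 dotC.
rewrite [in RHS]mxE (grad_coord _ _ df) [dot _ _](bigD1 i)//= big1 ?addr0; last first.
  by move=> j ji; rewrite mxE eqxx (negbTE ji) mul0r.
by rewrite !mxE !eqxx mul1r /GRing.scale/= mulrA divfK.
Qed.

(** Linearizing the squared distance to [c] at [p] loses exactly the squared distance from [u] to
    [p]. *)
Lemma lin_convexified f (l : R) c u p : differentiable f p ->
  lin (convexified f l c) u p =
  lin f u p + l / 2 * (dot (u - c) (u - c) - dot (u - p) (u - p)).
Proof.
move=> df; rewrite /lin grad_convexified// /convexified sqr_enorm !dotE.
by rewrite !(dotC c p) !(dotC u c) !(dotC u p); field.
Qed.

Lemma lin_affine f (t : R) u1 u2 p :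
  lin f (t *: u1 + (1 - t) *: u2) p = t * lin f u1 p + (1 - t) * lin f u2 p.
Proof. rewrite /lin !dotE; ring. Qed.

Lemma convex_setP (D : set 'rV[R]_n) :
  convex_set (D : set (convex_lmodType 'rV[R]_n)) ->
  forall (t : R) u z, 0 <= t <= 1 -> D u -> D z -> D (t *: u + (1 - t) *: z).
Proof.
move=> cD t u z /andP[t0 t1] Du Dz.
have /= := cD u z (Itv01 t0 t1).
by rewrite !inE; apply.
Qed.

Section descent.
Variables (D : set 'rV[R]_n) (f : 'rV[R]_n -> R^o) (L : R).
Hypotheses (L_gt0 : 0 < L)
  (D_convex : convex_set (D : set (convex_lmodType 'rV[R]_n)))
  (f_diff : forall u, D u -> differentiable f u)
  (f_lip : forall u1 u2, D u1 -> D u2 ->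
     enorm (grad f u1 - grad f u2) <= L * enorm (u1 - u2)).

Lemma dot_grad_lip u z (t : R) : D u -> D z -> 0 <= t <= 1 ->
  `|dot (grad f (z + t *: (u - z)) - grad f z) (u - z)|
    <= L * t * dot (u - z) (u - z).
Proof.
move=> Du Dz /andP[t0 t1].
(* [dot_ge_lip] and [dot_le_lip] need a positive constant, here [L * t]. *)
have [->|t_neq0] := eqVneq t 0.
  by rewrite scale0r addr0 subrr dot0l normr0 mulr0 mul0r.
have tgt0 : 0 < t by rewrite lt_neqAle eq_sym t_neq0.
have Dzt : D (z + t *: (u - z)).
  have := @convex_setP _ D_convex t u z; rewrite t0 t1 => /(_ isT Du Dz).
  by congr D; rewrite scalerBr scalerBl scale1r addrCA addrA.
have := enorm_leZ (ltW L_gt0) (f_lip Dzt Dz).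
have -> : z + t *: (u - z) - z = t *: (u - z) by rewrite addrAC subrr add0r.
rewrite dotZl dotZr => hl.
rewrite ler_norml; apply/andP; split.
  by apply: dot_ge_lip; [exact: mulr_gt0 | rewrite exprMn -mulrA (expr2 t) -mulrA].
by apply: dot_le_lip; [exact: mulr_gt0 | rewrite exprMn -mulrA (expr2 t) -mulrA].
Qed.

(** Both signs matter because [f] may be nonconvex: one bounds [phi] at the proximal point, the
    other bounds linearizations from above. *)
Lemma descent u z : D u -> D z ->
  `|f u - lin f u z| <= L / 2 * dot (u - z) (u - z).
Proof.
move=> Du Dz; pose d := u - z; pose q := dot d d.
have Dl (t : R) : 0 <= t <= 1 -> D (z + t *: d).
  move=> t01; have := @convex_setP _ D_convex t u z t01 Du Dz.
  by congr D; rewrite scalerBr scalerBl scale1r addrCA addrA.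
have fl (t : R) : 0 <= t <= 1 ->
    is_derive t 1 (fun s : R => f (z + s *: d) : R) (dot (grad f (z + t *: d)) d).
  by move=> /Dl/f_diff; exact: is_derive_line.
(* The sign [e] treats both inequalities at once. The mean value theorem gives [G 1 - G 0 = G' t]
   for some [t], and [dot_grad_lip] makes [G' t] nonpositive. *)
have key (e : R) : `|e| = 1 ->
    e * (f u - lin f u z) <= L / 2 * q.
  move=> e1.
  pose G := e *: (fun s : R => f (z + s *: d) : R) -
     (fun s : R => 0 + (s * (e * dot (grad f z) d) + s ^+ 2 * (L / 2 * q))).
  pose G' (t : R) := e * (dot (grad f (z + t *: d)) d - dot (grad f z) d) - L * t * q.
  have GD (t : R) : 0 <= t <= 1 -> is_derive t 1 G (G' t).
    move=> t01; apply: (is_derive_eq (is_deriveB (is_deriveZ e (fl t t01))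
      (is_derive_quadratic 0 (e * dot (grad f z) d) (L / 2 * q) t))).
    change (e * dot (grad f (z + t *: d)) d -
      (e * dot (grad f z) d + 2 * t * (L / 2 * q)) = G' t).
    have alg (A B Q : R) :
      e * A - (e * B + 2 * t * (L / 2 * Q)) = e * (A - B) - L * t * Q by field.
    exact: alg.
  have [] := @MVT_segment R G G' 0 1 ler01.
  - move=> t; rewrite in_itv/= => /andP[t0 t1]; apply: GD; rewrite !ltW//.
  - apply: derivable_within_continuous => t; rewrite in_itv/= => t01.
    by have [] := GD t t01.
  move=> t; rewrite in_itv/= subr0 mulr1 => t01 GE.
  have : G' t <= 0.
    rewrite /G' subr_le0 -dotNl -dotDl; apply: le_trans (ler_norm _) _.
    by rewrite normrM e1 mul1r dot_grad_lip.
  have GV (s : R) : G s =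
    e * f (z + s *: d) - (0 + (s * (e * dot (grad f z) d) + s ^+ 2 * (L / 2 * q))) by [].
  have alg (A B Q F : R) : e * A - (0 + (1 * (e * B) + 1 ^+ 2 * (L / 2 * Q))) -
      (e * F - (0 + (0 * (e * B) + 0 ^+ 2 * (L / 2 * Q)))) =
      e * (A - (F + B)) - L / 2 * Q by ring.
  by rewrite -GE !GV alg scale0r scale1r addr0 [z + d]addrC subrK subr_le0.
rewrite ler_norml; have := key 1 (normr1 _); have := key (-1) (normrN1 _).
by rewrite mul1r mulN1r lerNl => -> ->.
Qed.

End descent.

Section projection.
Variable D : set 'rV[R]_n.
Hypothesis D_convex : convex_set (D : set (convex_lmodType 'rV[R]_n)).

(** By convexity [p] competes with [t *: u + (1 - t) *: p]; this is the first-order condition as [t]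
    tends to 0. *)
Lemma proj_obtuse z p u : is_proj D z p -> D u -> dot (z - p) (u - p) <= 0.
Proof.
move=> [Dp pmin] Du; rewrite -(pmulr_rle0 _ (@ltr0n R 2)) -oppr_ge0.
apply: (@ge0_of_quadratic _ _ (dot (u - p) (u - p))) => t /andP[t0 t1].
have Dt : D (t *: u + (1 - t) *: p) by apply: convex_setP => //; rewrite !ltW.
have := pmin _ Dt; rewrite enorm_le_sqr.
have -> : z - (t *: u + (1 - t) *: p) = z - p - t *: (u - p).
  by rewrite scalerBl scale1r scalerBr !opprD !opprK !addrA; congr (_ + _); exact: addrAC.
have expand (w d : 'rV[R]_n) : dot (w - t *: d) (w - t *: d) =
    dot w w - t * (2 * dot w d) + t ^+ 2 * dot d d by rewrite !dotE (dotC d); ring.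
by rewrite expand mulrN; lra.
Qed.

Lemma proj_dist_le z p u : is_proj D z p -> D u ->
  dot (u - p) (u - p) <= dot (u - z) (u - z).
Proof.
move=> zp Du; have := proj_obtuse zp Du; have := dot_ge0 (z - p).
rewrite !dotE !(dotC u) !(dotC p z); lra.
Qed.

End projection.
End gradient.

(** * The momentum sequence *)

Section momentum.
Context {R : realType}.
Variable a : nat -> R.
Hypotheses (a0 : a 0%N = 1)
  (aS : forall k, 0 < a k.+1 /\ a k.+1 * (a k.+1 - 1) = a k ^+ 2).

(** The increment [a k.+1 - a k] lies between 1/2 and 1: [t * (t - 1)] is below [a k ^+ 2] at
    [a k + 1 / 2] and above it at [a k + 1]. *)
Lemma momentum_bounds k : 1 + k%:R / 2 <= a k <= 1 + k%:R.
Proof.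
elim: k => [|k]; first by rewrite a0 mul0r addr0 lexx.
have [apos aeq] := aS k; have k0 := ler0n R k.
rewrite -[k.+1]addn1 natrD => /andP[lo hi].
apply/andP; split.
  rewrite (@le_trans _ _ (a k + 1 / 2))//; first lra.
  rewrite leNgt addn1; apply/negP => h; nra.
rewrite (@le_trans _ _ (a k + 1))//; last lra.
by rewrite leNgt addn1; apply/negP => h; nra.
Qed.

Lemma momentum_ge1 k : 1 <= a k.
Proof. by have := momentum_bounds k; have := ler0n R k; lra. Qed.

(** The increments of [M ^+ 3 / 12] are at most [(1 + M / 2) ^+ 2], the lower bound on
    [a M ^+ 2]. *)
Lemma sum_sqr_momentum M : M%:R ^+ 3 / 12 <= \sum_(k < M) a k ^+ 2.
Proof.
elim: M => [|M IH]; first by rewrite big_ord0 expr0n mul0r.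
rewrite big_ord_recr/=; have /andP[lo _] := momentum_bounds M.
have M0 := ler0n R M.
have hM : (1 + M%:R / 2) ^+ 2 <= a M ^+ 2 by rewrite ler_sqr ?nnegrE//; lra.
rewrite -[M.+1]addn1 natrD; move: IH hM; lra.
Qed.

(** Once [e k <= d], each term is at most [(1 + k) * d], less than the increment of [d * k ^+ 2]
    plus [d * k ^+ 2] can absorb over the range; [K] collects the finitely many earlier terms. *)
Lemma sum_momentum_vanishing (e : nat -> R) : (forall k, 0 <= e k) ->
  e @ \oo --> 0 ->
  forall d, 0 < d -> exists K, forall M, \sum_(k < M) a k * e k <= K + d * M%:R ^+ 2.
Proof.
move=> e0 /cvgrPdist_le ecvg d d0.
have [M0 _ hM0] := ecvg _ d0.
have a_ge0 k : 0 <= a k by rewrite (le_trans _ (momentum_ge1 k)).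
exists (\sum_(k < M0) a k * e k) => M.
have [MM0|/ltnW] := leqP M M0.
  rewrite -(subnK MM0) addnC big_split_ord/= -addrA lerDl addr_ge0//.
    by apply: sumr_ge0 => i _; rewrite mulr_ge0.
  by rewrite mulr_ge0 ?exprn_ge0// ltW.
elim: M => [|M IH].
  by rewrite leqn0 => /eqP->; rewrite lerDl mulr_ge0 ?exprn_ge0// ltW.
rewrite leq_eqVlt => /predU1P[<-|].
  by rewrite lerDl mulr_ge0 ?exprn_ge0// ltW.
rewrite ltnS => M0M; rewrite big_ord_recr/=.
have {}IH := IH M0M.
have := hM0 _ M0M; rewrite sub0r normrN ger0_norm// => eM.
have /andP[_ hi] := momentum_bounds M.
have step : a M * e M <= (1 + M%:R) * d by rewrite ler_pM.
have := ler0n R M; rewrite -[M.+1]addn1 natrD; move: IH step; nra.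
Qed.

(** Applied to [g k = enorm (v k.+1)], whence the shift between [N eps] and [(N eps).-1]. *)
Lemma small_o_termination (g : nat -> R) : (forall k, 0 <= g k) ->
  (forall d, 0 < d -> exists K, forall M,
     \sum_(k < M) a k ^+ 2 * g k ^+ 2 <= K + d * M%:R ^+ 2) ->
  exists N : R -> nat,
    (forall eps, 0 < eps ->
      [/\ (1 <= N eps)%N, g (N eps).-1 <= eps &
          forall k, (k < (N eps).-1)%N -> eps < g k]) /\
    (N eps)%:R / eps ^- 2 @[eps --> 0^'+] --> (0 : R).
Proof.
move=> g0 gsum.
(* The constant [B] is independent of [eps]. For [M <= B + 1] the claim is immediate; beyond that,
   [K] is at most [d / 24 * M ^+ 2], and the cubic lower bound with its factor 1/12 leaves
   [eps ^+ 2 * M <= d]. *)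
have bound d : 0 < d -> exists2 B, 0 <= B & forall eps M, 0 < eps ->
    (forall k, (k < M)%N -> eps < g k) ->
    eps ^+ 2 * M%:R <= d + eps ^+ 2 * B.
  move=> d0; have d24 : 0 < d / 24 by rewrite divr_gt0.
  have [K HK] := gsum _ d24.
  have [B B0 KB] : exists2 B, 0 <= B & `|K| <= d / 24 * B.
    by exists (`|K| / (d / 24)); [rewrite divr_ge0// ltW | rewrite mulrC divfK// gt_eqF].
  exists (B + 1); first lra.
  move=> eps M eps0 gM; have M0 := ler0n R M.
  have e20 : 0 < eps ^+ 2 by rewrite exprn_gt0.
  have [Msmall|Mbig] := leP (M%:R : R) (B + 1).
    have : eps ^+ 2 * M%:R <= eps ^+ 2 * (B + 1) by rewrite ler_pM2l.
    lra.
  have lower : eps ^+ 2 * (M%:R ^+ 3 / 12) <= K + d / 24 * M%:R ^+ 2.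
    apply: le_trans (HK M); apply: (@le_trans _ _ (eps ^+ 2 * \sum_(k < M) a k ^+ 2)).
      by rewrite ler_pM2l// sum_sqr_momentum.
    rewrite mulr_sumr; apply: ler_sum => k _; rewrite mulrC ler_wpM2l ?sqr_ge0//.
    by rewrite ler_sqr ?nnegrE ?g0 ?ltW// gM.
  have KM : K <= d / 24 * M%:R ^+ 2.
    apply: le_trans (ler_norm K) _; apply: le_trans KB _.
    by rewrite ler_pM2l// expr2; nra.
  have M2 : 0 < (M%:R : R) ^+ 2 by rewrite exprn_gt0//; lra.
  have : eps ^+ 2 * M%:R <= d.
    rewrite -(ler_pM2r M2); move: lower KM; lra.
  have : 0 <= eps ^+ 2 * (B + 1) by rewrite mulr_ge0 ?ltW//; lra.
  lra.
have Nex eps : exists N : nat, 0 < eps ->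
    [/\ (1 <= N)%N, g N.-1 <= eps & forall k, (k < N.-1)%N -> eps < g k].
  (* The value 0 at nonpositive [eps] only makes the choice function total. *)
  have [eps0|] := ltP 0 eps; last by exists 0%N.
  have [ex|nex] := pselect (exists k, g k <= eps).
    exists (ex_minn ex).+1 => _; case: ex_minnP => m /= gm mmin; split => // k km.
    by rewrite ltNge; apply/negP => /mmin; rewrite leqNgt km.
  have [B B0 HB] := bound _ ltr01.
  have gbig k : eps < g k by rewrite ltNge; apply/negP => gk; apply: nex; exists k.
  have e20 : 0 < eps ^+ 2 by rewrite exprn_gt0.
  (* If the algorithm never stopped, [bound] with [d = 1] would hold for every [M]; this [M]
     violates it. *)
  have : ((1 + eps ^+ 2 * B) / eps ^+ 2) < (Num.truncn ((1 + eps ^+ 2 * B) / eps ^+ 2)).+1%:R.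
    exact: truncnS_gt.
  rewrite ltr_pdivrMr// [ltRHS]mulrC ltNge => /negP[].
  by apply: HB.
have [N HN] := choice Nex.
exists N; split => //.
apply/cvgrPdist_le => d d0.
have d20 : 0 < d / 2 by rewrite divr_gt0.
have [B B0 HB] := bound _ d20.
near=> eps.
have eps0 : 0 < eps by near: eps; exact: nbhs_right_gt.
have eps1 : eps <= 1 by near: eps; exact: nbhs_right_le.
(* [bound] controls [(N eps).-1]; the 1 in [B + 1] pays for the last iteration. *)
have epsd : eps <= d / 2 / (B + 1).
  by near: eps; apply: nbhs_right_le; rewrite divr_gt0// ltr_wpDl.
have [N1 _ Nbig] := HN _ eps0.
have := HB _ _ eps0 Nbig.
rewrite sub0r normrN invrK ger0_norm; last first.
  by rewrite mulr_ge0 ?exprn_ge0 ?ler0n// ltW.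
move=> hN.
rewrite -(prednK N1) -natr1.
have : eps ^+ 2 * (B + 1) <= d / 2.
  rewrite -ler_pdivlMr ?ltr_wpDl//; apply: le_trans epsd.
  by rewrite expr2 ler_piMl// ltW.
lra.
Unshelve. all: by end_near.
Qed.

End momentum.

(** * The proximal step *)

Section proper_convex.
Context {R : realType} {n : nat}.
Variable h : 'rV[R]_n -> \bar R.
Hypotheses (h_proper : ereal_proper h) (h_convex : ereal_convex h).

Lemma fine_edom u : edom h u -> h u = (fine (h u))%:E.
Proof.
move=> hu; rewrite fineK// fin_numE (proj1 h_proper)/=.
by move: hu; rewrite /edom/= ltey.
Qed.

Lemma edom_convex (t : R) u z : 0 <= t <= 1 -> edom h u -> edom h z ->
  edom h (t *: u + (1 - t) *: z) /\
  fine (h (t *: u + (1 - t) *: z)) <= t * fine (h u) + (1 - t) * fine (h z).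
Proof.
move=> /andP[t0 t1] hu hz.
have [->|tn0] := eqVneq t 0.
  by rewrite scale0r add0r subr0 scale1r mul0r mul1r add0r.
have [->|tn1] := eqVneq t 1.
  by rewrite subrr scale0r addr0 scale1r mul0r mul1r addr0.
have t01 : 0 < t < 1 by rewrite !lt_neqAle eq_sym tn0 t0 tn1.
have := h_convex u z t01; rewrite (fine_edom hu) (fine_edom hz) -!EFinM -EFinD => ht.
have hd : edom h (t *: u + (1 - t) *: z) by apply: le_lt_trans ht _; exact: ltry.
by split => //; rewrite -lee_fin -(fine_edom hd).
Qed.

(** Compare [y] with points of the segment towards [u], bounding [h] there by convexity, and keep
    the first-order term. The factor [4 * c] comes from differentiating the proximal term. *)
Lemma prox_subgradient (g : 'rV[R]_n -> R^o) (c : R) p y :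
  is_argmin (fun u => ((lin g u p)%R%:E + h u + (2 * c * enorm (u - p) ^+ 2)%:E)%E) y ->
  edom h y /\ forall u, edom h u ->
    fine (h y) + dot ((4 * c) *: (p - y) - grad g p) (u - y) <= fine (h u).
Proof.
move=> ymin.
(* The minimum is at most the finite value at a point of the domain. *)
have hy : edom h y.
  have [_ [u0 hu0]] := h_proper; have := ymin u0.
  rewrite (fine_edom hu0) -!EFinD /edom/= => /le_lt_trans/(_ (ltry _)).
  by case: (h y) (proj1 h_proper y) => [r _ _|//|//]; exact: ltry.
split=> // u hu; rewrite -subr_ge0.
apply: (@ge0_of_quadratic _ _ (2 * c * dot (u - y) (u - y))) => t /andP[t0 t1].
have [] := @edom_convex t u y _ hu hy; first by rewrite !ltW.
set ut := t *: u + _ => hut; have := ymin ut.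
rewrite (fine_edom hut) (fine_edom hy) -!EFinD lee_fin.
rewrite !sqr_enorm /ut lin_affine -/ut.
have -> : ut - p = y - p + t *: (u - y).
  by apply/rowP => i; rewrite !mxE; ring.
rewrite /lin !dotE !(dotC p y) !(dotC u y) !(dotC u p); lra.
Qed.

Lemma subdiffP y s : edom h y ->
  (forall u, edom h u -> fine (h y) + dot s (u - y) <= fine (h u)) ->
  subdiff h y s.
Proof.
move=> hy sub u; have [hu|] := boolP (h u < +oo)%E.
  by rewrite (fine_edom hy) (fine_edom hu) -EFinD lee_fin sub.
by rewrite ltey negbK => /eqP->; rewrite leey.
Qed.

End proper_convex.

(** Here 51 is 3 * (1 + 16): 3 from splitting a square into three, 1 from the Lipschitz bound on
    [G], and 16 from [(l - 4 * L) ^+ 2 <= 16 * L ^+ 2]. *)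
Lemma residual_arith {R : realFieldType} (l L G P Q : R) :
  0 < L -> 0 <= l -> l <= L -> G <= L ^+ 2 * P -> 0 <= P -> 0 <= Q ->
  3 * (G + l * (l * Q) + (l - 4 * L) * ((l - 4 * L) * P)) <=
  51 * L * (l / 2 * Q + L * P).
Proof.
move=> L0 l0 lL g P0 Q0.
have h1 : l * (l * Q) <= L * (l * Q) by rewrite ler_wpM2r// mulr_ge0.
have h2 : 0 <= l * (8 * L - l) * P by rewrite !mulr_ge0//; lra.
have h3 : 0 <= l * L * Q by rewrite !mulr_ge0// ltW.
lra.
Qed.

Section mFISTA.
Context {R : realType} {n : nat}.
Variables (Omega : set 'rV[R]_n) (f : 'rV[R]_n -> R^o) (h : 'rV[R]_n -> \bar R) (L : R).
Hypotheses (Omega_convex : convex_set (Omega : set (convex_lmodType 'rV[R]_n)))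
  (L_gt0 : 0 < L)
  (f_diff : forall u, Omega u -> differentiable f u)
  (f_lip : forall u1 u2, Omega u1 -> Omega u2 ->
     enorm (grad f u1 - grad f u2) <= L * enorm (u1 - u2))
  (h_proper : ereal_proper h) (h_convex : ereal_convex h)
  (dom_Omega : edom h `<=` Omega).

Let phi u : R := f u + fine (h u).

(** * One iteration of the algorithm *)

Section step.
Variables (X Y Z : 'rV[R]_n) (l : R).
Hypotheses (XO : Omega X) (hY : edom h Y) (l_ge0 : 0 <= l) (l_leL : l <= L)
  (Z_argmin : is_argmin (fun u => ((lin (convexified f l Y) u X)%R%:E + h u
               + (2 * L * enorm (u - X) ^+ 2)%:E)%E) Z).

(** The gain left over by a proximal step, which also dominates the squared residual. *)
Definition progress : R := l / 2 * dot (Z - Y) (Z - Y) + L * dot (Z - X) (Z - X).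

Lemma progress_ge0 : 0 <= progress.
Proof. by rewrite addr_ge0// mulr_ge0 ?dot_ge0 ?divr_ge0// ltW. Qed.

(** Strong convexity of the proximal term yields the distance from [u] to [Z]. Of its coefficient
    [2 * L] at [Z], [L / 2] pays for the descent lemma and [l / 2 <= L / 2] for linearizing the
    convexification; at least [L] remains for [progress]. *)
Lemma prox_decrease u : edom h u ->
  phi Z + progress + 2 * L * dot (u - Z) (u - Z) <=
  lin (convexified f l Y) u X + fine (h u) + 2 * L * dot (u - X) (u - X).
Proof.
move=> hu; have [hZ /(_ u hu)] := prox_subgradient h_proper h_convex Z_argmin.
have := descent L_gt0 Omega_convex f_diff f_lip (dom_Omega hZ) XO.
move=> /ler_normlW.
have dZX := dot_ge0 (Z - X).
have lZX : l * dot (Z - X) (Z - X) <= L * dot (Z - X) (Z - X) by rewrite ler_wpM2r.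
rewrite lin_convexified; last exact: f_diff.
rewrite grad_convexified; last exact: f_diff.
move: lZX dZX; rewrite /phi /progress /lin; set gX := grad f X.
rewrite !dotE ?(dotC X Y) ?(dotC Z Y) ?(dotC Z X) ?(dotC u Y) ?(dotC u X) ?(dotC u Z).
lra.
Qed.

(* [u] is the point at which the classical FISTA argument tests the optimality
   of [Z]; nonconvexity of [f] costs the two squared distances to [w]. *)
Lemma potential_step (b : R) w : 1 <= b -> edom h w ->
  lin f Y X - f Y <= l / 2 * dot (Y - X) (Y - X) ->
  let u := b^-1 *: w + (1 - b^-1) *: Y in
  b ^+ 2 * (phi Z - phi w) + b ^+ 2 * progress
    + 2 * L * dot (w - (b *: Z - (b - 1) *: Y)) (w - (b *: Z - (b - 1) *: Y)) <=
  (b ^+ 2 - b) * (phi Y - phi w)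
    + b * (L / 2 * (dot (X - w) (X - w) + dot (Y - w) (Y - w)))
    + 2 * L * (b ^+ 2 * dot (u - X) (u - X)).
Proof.
move=> b1 hw curvY; cbv zeta.
have b0 : 0 < b by lra.
have bt : b / b = 1 by rewrite mulfV// gt_eqF.
have t0 : 0 <= b^-1 by rewrite invr_ge0 ltW.
have t1 : b^-1 <= 1 by rewrite invf_le1.
move: (b^-1) bt t0 t1 => t bt t0 t1; set u := t *: w + _.
have [hu hconv] := @edom_convex _ _ _ h_proper h_convex t w Y (introT andP (conj t0 t1)) hw hY.
have := prox_decrease hu.
have -> : w - (b *: Z - (b - 1) *: Y) = b *: (u - Z).
  apply/rowP => i; rewrite !mxE.
  have -> : b * (t * w 0 i + (1 - t) * Y 0 i - Z 0 i) =
    (b * t) * w 0 i + (b - b * t) * Y 0 i - b * Z 0 i by ring.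
  by rewrite bt; ring.
rewrite dotZl dotZr.
rewrite {2}/u lin_affine.
(* At [Y] the curvature hypothesis replaces convexity, so no error arises. *)
have mY : lin (convexified f l Y) Y X <= f Y.
  rewrite lin_convexified; last exact: f_diff.
  by rewrite subrr dot0l sub0r mulrN; lra.
(* At [w] only smoothness is available: the descent lemma costs the distance to [X], and the
   convexification the distance to [Y]. *)
have mw : lin (convexified f l Y) w X <=
    f w + L / 2 * (dot (X - w) (X - w) + dot (Y - w) (Y - w)).
  rewrite lin_convexified; last exact: f_diff.
  have := descent L_gt0 Omega_convex f_diff f_lip (dom_Omega hw) XO.
  rewrite ler_norml => /andP[+ _].
  rewrite (dot_subC w X) (dot_subC w Y).
  have := mulr_ge0 l_ge0 (dot_ge0 (X - w)); have := ler_wpM2r (dot_ge0 (Y - w)) l_leL.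
  lra.
set mu := t * _ + _; move=> main.
have {main} : phi Z + progress + 2 * L * dot (u - Z) (u - Z) <=
   t * (phi w + L / 2 * (dot (X - w) (X - w) + dot (Y - w) (Y - w)))
   + (1 - t) * phi Y + 2 * L * dot (u - X) (u - X).
  apply: le_trans main _; rewrite lerD2r /phi /mu.
  move: hconv; rewrite -/u => hconv.
  have t1' : 0 <= 1 - t by rewrite subr_ge0.
  move: hconv (ler_wpM2l t0 mw) (ler_wpM2l t1' mY).
  move: (L / 2 * _) (lin _ w X) (lin _ Y X) (fine _) (fine _) (fine _) (f w) (f Y).
  by move=> e mw' mY' hu' hw' hY' fw fY; lra.
(* Multiplying by [b ^+ 2] and using [b * t = 1] gives the weights of the potential. *)
move=> /(ler_wpM2l (sqr_ge0 b)).
move: (L / 2 * _) (dot (u - X) _) (dot (u - Z) _) (phi Z) (phi Y) (phi w) progress.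
move=> e q2 q1 pZ pY pw pr.
have -> : b ^+ 2 * (t * (pw + e) + (1 - t) * pY + 2 * L * q2) =
  (b * t) * b * (pw + e) + (b ^+ 2 - (b * t) * b) * pY + b ^+ 2 * (2 * L * q2) by ring.
rewrite bt => main; rewrite -subr_ge0.
by move: main; rewrite -subr_ge0; congr (0 <= _); ring.
Qed.

Lemma residual_le : edom h Z ->
  let V := grad f Z - grad f X + l *: (Y - X) + (4 * L) *: (X - Z) in
  dot V V <= 51 * L * progress.
Proof.
move=> hZ /=.
(* Passing through [Z] leaves only the displacements measured by [progress]. *)
have regroup (gd : 'rV[R]_n) : gd + l *: (Y - X) + (4 * L) *: (X - Z) =
    gd + l *: (Y - Z) + (l - 4 * L) *: (Z - X).
  by apply/rowP => i; rewrite !mxE; ring.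
rewrite regroup.
apply: le_trans (dotD3_le _ _ _) _.
have g := enorm_leZ (ltW L_gt0) (f_lip (dom_Omega hZ) XO).
rewrite !dotZl !dotZr /progress.
rewrite (dot_subC Y Z).
have P0 := dot_ge0 (Z - X); have Q0 := dot_ge0 (Z - Y).
move: g P0 Q0; move: (dot (grad _ _ - _) _) (dot (Z - X) _) (dot (Z - Y) _).
by move=> G P Q; exact: residual_arith.
Qed.

End step.

(** * The iterates and their potential *)

Section run.
Variables (x y v : nat -> 'rV[R]_n) (a Ls : nat -> R).
Hypothesis run : mFISTA_run Omega f h L x y v a Ls.

Lemma run_y_edom k : edom h (y k).
Proof.
case: k => [|k]; first exact: run_y0 run.
by have [] := prox_subgradient h_proper h_convex (run_y run k).
Qed.

Lemma run_x_Omega k : Omega (x k.+1).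
Proof.
case: k => [|k]; last by have [] := run_x run k.
by rewrite (run_x1 run); exact/dom_Omega/run_y_edom.
Qed.

(** The descent lemma caps the curvature quotient at [L]. *)
Lemma run_Ls_bounds k : 0 <= Ls k.+1 <= L.
Proof.
case: k => [|k]; first by rewrite (run_L1 run) lexx ltW.
rewrite (run_L run) le_max lexx/= ge_max ltW//= /curvature.
case: eqP => [_|/eqP yx]; first exact: ltW.
have yx0 := dot_sub_gt0 yx.
rewrite sqr_enorm ler_pdivrMr//.
have := descent L_gt0 Omega_convex f_diff f_lip (dom_Omega (run_y_edom k.+1)) (run_x_Omega k.+1).
by rewrite ler_norml => /andP[+ _]; lra.
Qed.

Lemma run_curvature k :
  lin f (y k) (x k.+1) - f (y k) <=
  Ls k.+1 / 2 * dot (y k - x k.+1) (y k - x k.+1).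
Proof.
case: k => [|k].
  by rewrite (run_x1 run) /lin subrr !dot0r addr0 subrr mulr0.
have [yx|yx] := eqVneq (y k.+1) (x k.+2).
  by rewrite -yx /lin subrr !dot0r addr0 subrr mulr0.
have yx0 := dot_sub_gt0 yx.
have : curvature f (y k.+1) (x k.+2) <= Ls k.+2 by rewrite (run_L run) le_max lexx orbT.
by rewrite /curvature (negbTE yx) sqr_enorm ler_pdivrMr//; lra.
Qed.

Let a_ge1 k : 1 <= a k := momentum_ge1 (run_a0 run) (run_a run) k.

Let s k := progress (x k.+1) (y k) (y k.+1) (Ls k.+1).

Lemma run_residual k : enorm (v k.+1) ^+ 2 <= 51 * L * s k.
Proof.
have /andP[l0 lL] := run_Ls_bounds k.
rewrite sqr_enorm (run_v run); apply: residual_le => //.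
- exact: run_x_Omega.
- exact: run_y_edom.
Qed.

(** Removing [grad f (y k.+1)] from [v k.+1] leaves exactly the subgradient supplied by optimality
    of the proximal step. *)
Lemma run_approx_solution k eps :
  enorm (v k.+1) <= eps -> approx_solution f h eps (y k.+1) (v k.+1).
Proof.
move=> vk; split=> //.
have [hy sub] := prox_subgradient h_proper h_convex (run_y run k).
exists ((4 * L) *: (x k.+1 - y k.+1) - grad (convexified f (Ls k.+1) (y k)) (x k.+1)).
  exact: subdiffP.
rewrite (run_v run) grad_convexified; last exact/f_diff/run_x_Omega.
have vecE (gy gx : 'rV[R]_n) :
  gy - gx + Ls k.+1 *: (y k - x k.+1) + (4 * L) *: (x k.+1 - y k.+1) =
  gy + ((4 * L) *: (x k.+1 - y k.+1) - (gx + Ls k.+1 *: (x k.+1 - y k))).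
  by apply/rowP => i; rewrite !mxE; ring.
exact: vecE.
Qed.

(* The auxiliary sequence (z_k) of FISTA, along which the potential contracts. *)
Let z k := if k is k'.+1 then a k' *: y k - (a k' - 1) *: y k' else y 0.

(** Projection onto [Omega] does not increase the distance to [u], and [a k] times [u] minus the
    unprojected extrapolation is [w - z k]. At [k = 0] this is an equality. *)
Lemma run_extrapolation k w : edom h w ->
  let u := (a k)^-1 *: w + (1 - (a k)^-1) *: y k in
  a k ^+ 2 * dot (u - x k.+1) (u - x k.+1) <= dot (w - z k) (w - z k).
Proof.
move=> hw /=; set u := _ *: w + _.
case: k @u => [|k] u.
  rewrite /u (run_a0 run) invr1 subrr scale0r addr0 scale1r expr1n mul1r.
  by rewrite (run_x1 run).
have a1 := a_ge1 k.+1; have a0 : a k.+1 != 0 by rewrite gt_eqF//; lra.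
have Ou : Omega u.
  apply/dom_Omega/(proj1 (edom_convex h_proper h_convex _ hw (run_y_edom _))).
  by rewrite invr_ge0 invf_le1 ?a1 ?andbT; lra.
have := proj_dist_le Omega_convex (run_x run k) Ou.
rewrite -(ler_pM2l (_ : 0 < a k.+1 ^+ 2)); last by rewrite exprn_gt0//; lra.
move=> /le_trans; apply; rewrite expr2 -mulrA -dotZr -dotZl.
suff -> : a k.+1 *: (u - (y k.+1 + ((a k - 1) / a k.+1) *: (y k.+1 - y k))) = w - z k.+1 by [].
by apply/rowP => i; rewrite /u /z !mxE; field.
Qed.

(** The steps telescope because [a k.+1 ^+ 2 - a k.+1 = a k ^+ 2]; the first one has no objective
    term on the right, as [a 0 = 1]. *)
Lemma run_potential w M : edom h w ->
  a M ^+ 2 * (phi (y M.+1) - phi w) + \sum_(k < M.+1) a k ^+ 2 * s k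
    + 2 * L * dot (w - z M.+1) (w - z M.+1) <=
  2 * L * dot (w - y 0) (w - y 0)
    + \sum_(k < M.+1) a k * (L / 2 * (dot (x k.+1 - w) (x k.+1 - w)
                                     + dot (y k - w) (y k - w))).
Proof.
move=> hw.
have step k : a k ^+ 2 * (phi (y k.+1) - phi w) + a k ^+ 2 * s k
    + 2 * L * dot (w - z k.+1) (w - z k.+1) <=
  (a k ^+ 2 - a k) * (phi (y k) - phi w)
    + a k * (L / 2 * (dot (x k.+1 - w) (x k.+1 - w) + dot (y k - w) (y k - w)))
    + 2 * L * dot (w - z k) (w - z k).
  have /andP[l0 lL] := run_Ls_bounds k.
  have := potential_step (run_x_Omega k) (run_y_edom k) l0 lL (run_y run k)
    (a_ge1 k) hw (run_curvature k).
  move=> /= /le_trans; apply; rewrite lerD2l ler_pM2l ?mulr_gt0//.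
  exact: run_extrapolation.
elim: M => [|M IH]; last first.
  rewrite !(big_ord_recr M.+1)/=.
  have := step M.+1.
  have -> : a M.+1 ^+ 2 - a M.+1 = a M ^+ 2.
    by have [_ <-] := run_a run M; rewrite mulrBr mulr1 expr2.
  move: IH; set S1 := \sum_(k < M.+1) _; set S2 := \sum_(k < M.+1) _.
  set A := a M ^+ 2 * _; set D := 2 * L * dot (w - z M.+1) _.
  set F := _ * (L / 2 * _); set G := a M.+1 ^+ 2 * s _.
  set H := a M.+1 ^+ 2 * (_ - _); set J := 2 * L * _; set K := 2 * L * _.
  by move: S1 S2 A D F G H J K => *; lra.
have := step 0%N; rewrite !big_ord_recr !big_ord0/= !add0r.
rewrite (run_a0 run) expr1n subrr mul0r add0r addrC.
set S1 := 2 * L * _; set S2 := 2 * L * _ ; set S3 := _ * (phi _ - _).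
set S4 := 1 * _; set S5 := _ * (L / 2 * _).
by move: S1 S2 S3 S4 S5 => *; lra.
Qed.

(** * Consequences of convergence *)

Section limit.
Variable w : 'rV[R]_n.
Hypotheses (hw : edom h w) (y_w : y @ \oo --> w) (h_lsc : lower_semicontinuous h).

Let r k := dot (y k - w) (y k - w).

Lemma dist2_limit : r @ \oo --> 0.
Proof.
have q_cont := differentiable_continuous (differentiable_dist2 w w).
have := @cvg_comp _ _ _ y (fun u : 'rV[R]_n => dot (u - w) (u - w)) _ _ _ y_w q_cont.
by rewrite subrr dot0l.
Qed.

(** The projected point is within [c * enorm (y k.+1 - y k)] of [y k.+1], with [c <= 1]; two
    triangle inequalities through [y k.+1] and [w] give the constants. *)
Lemma run_x_dist2 k :
  dot (x k.+2 - w) (x k.+2 - w) <= 6 * r k.+1 + 4 * r k.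
Proof.
have a1 := a_ge1 k; have aS1 := a_ge1 k.+1.
pose c := (a k - 1) / a k.+1.
have := proj_dist_le Omega_convex (run_x run k) (dom_Omega (run_y_edom k.+1)).
have -> : y k.+1 - (y k.+1 + ((a k - 1) / a k.+1) *: (y k.+1 - y k)) =
    - (c *: (y k.+1 - y k)).
  by rewrite opprD addNKr.
have c0 : 0 <= c by rewrite divr_ge0//; lra.
have c1 : c <= 1.
  rewrite ler_pdivrMr ?mul1r; last lra.
  have [_ aE] := run_a run k; rewrite leNgt; apply/negP => h1; nra.
rewrite [in leRHS]dotNl dotNr opprK dotZl dotZr.
have := dist2_triangle (x k.+2) (y k.+1) w.
have := dist2_triangle (y k.+1) w (y k).
rewrite (dot_subC w (y k)) (dot_subC (x k.+2) (y k.+1)) /r.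
have := dot_ge0 (y k.+1 - y k).
move: (dot (y k.+1 - y k) _) (dot (y k.+1 - w) _) (dot (y k - w) _)
  (dot (y k.+1 - x k.+2) _) (dot (x k.+2 - w) _) => P Q S T U P0 h1 h2 h3.
have h4 : c * (c * P) <= P by rewrite mulrA ler_piMl// mulr_ile1.
lra.
Qed.

Let e k := L / 2 * (dot (x k.+1 - w) (x k.+1 - w) + dot (y k - w) (y k - w)).

Lemma nonconvexity_error_cvg : e @ \oo --> 0.
Proof.
(* The bound on [x] starts at index 2; 7 is its 6 plus the term [r k.+1] already in [e]. *)
rewrite -(cvg_shiftS e).
have bnd : (fun k => L / 2 * (7 * r k.+1 + 4 * r k)) @ \oo --> (0 : R).
  rewrite -[X in _ --> X](_ : L / 2 * (7 * 0 + 4 * 0) = 0); last by rewrite !mulr0 addr0 mulr0.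
  apply: cvgMr; apply: cvgD; apply: cvgMr; last exact: dist2_limit.
  by rewrite (cvg_shiftS r); exact: dist2_limit.
apply: (squeeze_cvgr _ (cvg_cst 0) bnd); apply: nearW => k.
have L2 : 0 <= L / 2 by rewrite divr_ge0// ltW.
rewrite /e mulr_ge0 ?addr_ge0 ?dot_ge0//= ler_wpM2l//.
by have := run_x_dist2 k; rewrite -/(r k.+1); lra.
Qed.

(** Continuity of [f] at [w] and lower semicontinuity of [h] each cost [d / 2]. *)
Lemma objective_liminf d : 0 < d -> \forall k \near \oo, phi w - d <= phi (y k).
Proof.
move=> d0; have d20 : 0 < d / 2 by rewrite divr_gt0.
have f_cont := differentiable_continuous (f_diff (dom_Omega hw)).
have fy : (fun k => f (y k)) @ \oo --> f w by exact: (@cvg_comp _ _ _ y f _ _ _ y_w f_cont).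
have {}fy : \forall k \near \oo, `|f w - f (y k)| <= d / 2.
  by move/cvgrPdist_le: fy => /(_ _ d20).
have [|V wV hV] := h_lsc (x := w) (a := fine (h w) - d / 2).
  by rewrite [ltRHS](fine_edom h_proper hw) lte_fin; lra.
near=> k.
have : `|f w - f (y k)| <= d / 2.
  by near: k; exact: fy.
have /hV : V (y k) by near: k; exact: y_w.
rewrite (fine_edom h_proper (run_y_edom k)) lte_fin /phi ler_norml => ? /andP[_ ?].
lra.
Unshelve. all: by end_near.
Qed.

Lemma run_progress_small d : 0 < d ->
  exists K, forall M, \sum_(k < M) a k ^+ 2 * s k <= K + d * M%:R ^+ 2.
Proof.
move=> d0; have d20 : 0 < d / 2 by rewrite divr_gt0.
have e0 k : 0 <= e k.
  by rewrite /e mulr_ge0 ?divr_ge0 ?addr_ge0 ?dot_ge0// ltW.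
have [K HK] := sum_momentum_vanishing (run_a0 run) (run_a run) e0
  nonconvexity_error_cvg d20.
have K0 : 0 <= K by have := HK 0%N; rewrite big_ord0 expr0n mulr0 addr0.
have [M0 _ HM0] := objective_liminf d20.
have s0 k : 0 <= a k ^+ 2 * s k.
  have /andP[l0 _] := run_Ls_bounds k.
  by rewrite mulr_ge0 ?sqr_ge0// progress_ge0.
set S := fun M : nat => \sum_(k < M) a k ^+ 2 * s k.
have S0 M : 0 <= S M by exact: sumr_ge0.
(* [S M0] covers the indices before the objective bound holds, the middle term is the initial
   potential, and [K] comes from the nonconvexity errors. *)
exists (S M0 + 2 * L * dot (w - y 0) (w - y 0) + K) => M; rewrite -/(S M).
have c0 : 0 <= 2 * L * dot (w - y 0) (w - y 0).
  by rewrite mulr_ge0 ?dot_ge0// mulr_ge0// ltW.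
have [MM0|M0M] := leqP M M0.
  have SM : S M <= S M0.
    by rewrite /S -(subnK MM0) addnC big_split_ord/= lerDl sumr_ge0.
  have : 0 <= d * M%:R ^+ 2 by rewrite mulr_ge0 ?exprn_ge0 ?ler0n// ltW.
  lra.
case: M M0M => // M M0M.
have := run_potential M hw; have := HK M.+1; rewrite -/(S M.+1) /e.
have := HM0 M.+1 (ltnW M0M).
have : a M ^+ 2 <= M.+1%:R ^+ 2.
  have /andP[_ hi] := momentum_bounds (run_a0 run) (run_a run) M.
  rewrite ler_sqr ?nnegrE ?ler0n//; first by rewrite -natr1 addrC.
  by have := a_ge1 M; lra.
have := sqr_ge0 (a M); have := S0 M0.
have : 0 <= 2 * L * dot (w - z M.+1) (w - z M.+1).
  by rewrite mulr_ge0 ?dot_ge0// mulr_ge0// ltW.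
move: (2 * L * _) (2 * L * _) (phi (y M.+1)) (phi w) (S M0) (S M.+1) (a M ^+ 2)
  (M.+1%:R ^+ 2) (\sum_(k < M.+1) _) c0 => B1 B2 p1 p2 S1 S2 A Q T c0.
move=> h1 h2 h3 h4 h5 h6 h7.
(* The final objective term may be negative, but costs at most the second half of [d]. *)
have : A * (p2 - d / 2 - p1) <= 0 by rewrite mulr_ge0_le0//; lra.
have : d / 2 * A <= d / 2 * Q by rewrite ler_wpM2l// ltW.
move: K0; lra.
Qed.

Lemma run_termination : exists N : R -> nat,
  (forall eps : R, 0 < eps ->
     terminates_at v eps (N eps) /\
     approx_solution f h eps (y (N eps)) (v (N eps))) /\
  (N eps)%:R / eps ^- 2 @[eps --> 0^'+] --> (0 : R).
Proof.
have c0 : 0 < 51 * L by rewrite mulr_gt0.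
have [|d d0|N [HN Ncvg]] := small_o_termination (run_a0 run) (run_a run)
    (g := fun k => enorm (v k.+1)).
- by move=> k; exact: enorm_ge0.
(* Dividing [d] by [51 * L] offsets the constant of [run_residual]. *)
- have [K HK] := run_progress_small (divr_gt0 d0 c0).
  exists (51 * L * K) => M; have := HK M; rewrite -(ler_pM2l c0).
  rewrite mulrDr mulrA [_ * (d / _)]mulrC divfK ?gt_eqF//; apply: le_trans.
  rewrite mulr_sumr; apply: ler_sum => k _.
  by rewrite /= [leRHS]mulrCA ler_wpM2l ?sqr_ge0 ?run_residual.
exists N; split=> // eps /HN[N1 vN Nmin]; rewrite prednK// in vN.
split; last by rewrite -(prednK N1) in vN *; exact: run_approx_solution.
split=> // k /andP[k1 kN]; rewrite -(prednK k1); apply: Nmin.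
by rewrite -ltnS !prednK.
Qed.

End limit.
End run.
End mFISTA.

Theorem theorem4p5 (R : realType) (n : nat)
  (Omega : set 'rV[R]_n) (f : 'rV[R]_n -> R^o) (h : 'rV[R]_n -> \bar R)
  (L C : R)
  (Omega_closed : closed Omega)
  (Omega_convex : convex_set (Omega : set (convex_lmodType 'rV[R]_n)))
  (L_gt0 : 0 < L)
  (f_diff : forall u, Omega u -> differentiable f u)
  (f_lip : forall u1 u2, Omega u1 -> Omega u2 ->
     enorm (grad f u1 - grad f u2) <= L * enorm (u1 - u2))
  (h_proper : ereal_proper h)
  (h_lsc : lower_semicontinuous h)
  (h_convex : ereal_convex h)
  (dom_closed : closed (edom h))
  (dom_bounded : bounded_set (edom h))
  (dom_Omega : edom h `<=` Omega)
  (C_gt0 : 0 < C)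
  (dom_C : forall y, edom h y -> enorm y <= C)
  (x y v : nat -> 'rV[R]_n) (a Ls : nat -> R)
  (run : mFISTA_run Omega f h L x y v a Ls)
  (y_cvg : cvgn y) :
  exists N : R -> nat,
    (forall eps : R, 0 < eps ->
       terminates_at v eps (N eps) /\
       approx_solution f h eps (y (N eps)) (v (N eps))) /\
    (N eps)%:R / eps ^- 2 @[eps --> 0^'+] --> (0 : R).
Proof.
(* The limit serves as comparison point, so [h] must be finite there; closedness of the domain
   ensures it. *)
have hw : edom h (lim (y @ \oo)).
  apply: (@closed_cvg _ _ _ _ y (edom h) dom_closed _ _ y_cvg).
  by apply: nearW => k; exact: (run_y_edom h_proper h_convex run).
exact: (run_termination Omega_convex L_gt0 f_diff f_lip h_proper h_convex
  dom_Omega run hw y_cvg h_lsc).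
Qed.
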